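(* Let $M$ be a bicomplex Hilbert space. Then, for $k=1,2$, $(V_k,(\cdot,\cdot)_{\widehat k})$ is a complex (over $\mathbb{C}(\mathbf{i_1})$) Hilbert space.
   Context: Bicomplex numbers: $\mathbb{T}=\{z_1+z_2\mathbf{i_2} : z_1,z_2\in\mathbb{C}(\mathbf{i_1})\}$ with $\mathbb{C}(\mathbf{i_1})=\{x+y\mathbf{i_1}: x,y\in\mathbb{R}\}$, $\mathbf{i_1}^2=\mathbf{i_2}^2=-1$, $\mathbf{j}=\mathbf{i_1}\mathbf{i_2}=\mathbf{i_2}\mathbf{i_1}$, $\mathbf{j}^2=1$; this is a commutative ring. Put $\mathbf{e_1}=(1+\mathbf{j})/2$, $\mathbf{e_2}=(1-\mathbf{j})/2$, so $\mathbf{e_1}+\mathbf{e_2}=1$, $\mathbf{e_1}\mathbf{e_2}=0$, $\mathbf{e_k}^2=\mathbf{e_k}$. Each $w\in\mathbb{T}$ is uniquely $w=z_{\widehat 1}\mathbf{e_1}+z_{\widehat 2}\mathbf{e_2}$ with $z_{\widehat k}\in\mathbb{C}(\mathbf{i_1})$; put $P_k(w)=z_{\widehat k}$ and $w^{\dagger_3}=\bar z_{\widehat 1}\mathbf{e_1}+\bar z_{\widehat 2}\mathbf{e_2}$ (bar = complex conjugation in $\mathbb{C}(\mathbf{i_1})$). Let $\mathbb{D}^+=\{x_{\widehat 1}\mathbf{e_1}+x_{\widehat 2}\mathbf{e_2}: x_{\widehat 1},x_{\widehat 2}\in\mathbb{R},\ x_{\widehat 1},x_{\widehat 2}\ge 0\}$.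 For a $\mathbb{T}$-module $M$ and $k=1,2$, $V_k=\mathbf{e_k}M=\{\mathbf{e_k}\psi:\psi\in M\}$, a vector space over $\mathbb{C}(\mathbf{i_1})$. A bicomplex scalar product on $M$ is a map $(\cdot,\cdot):M\times M\to\mathbb{T}$ such that for all $\psi,\phi,\chi\in M$, $\alpha\in\mathbb{T}$: (1) $(\psi,\phi+\chi)=(\psi,\phi)+(\psi,\chi)$; (2) $(\psi,\alpha\phi)=\alpha(\psi,\phi)$; (3) $(\psi,\phi)=(\phi,\psi)^{\dagger_3}$; (4) $(\psi,\psi)=0\Leftrightarrow\psi=0$. Standing assumption: it is hyperbolic positive, i.e. $(\psi,\psi)\in\mathbb{D}^+$ for all $\psi\in M$. Then $\{M,(\cdot,\cdot)\}$ is called a bicomplex pre-Hilbert space (or $\mathbb{T}$-inner product space). Write $(\cdot,\cdot)_{\widehat k}=P_k((\cdot,\cdot))$. The induced $\mathbb{T}$-norm is $\|\phi\|=\frac{1}{\sqrt2}\sqrt{(\mathbf{e_1}\phi,\mathbf{e_1}\phi)_{\widehat 1}+(\mathbf{e_2}\phi,\mathbf{e_2}\phi)_{\widehat 2}}$. A bicomplex Hilbert space is a $\mathbb{T}$-inner product space that is complete with respect to $\|\cdot\|$. Complex scalar products are linear in the second argument. *)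

(* Defs.v *)
From HB Require Import structures.
From mathcomp Require Import all_boot all_order all_algebra.
From mathcomp Require Import boolp reals.
From mathcomp Require Import complex ring.

Set Implicit Arguments.
Unset Strict Implicit.
Unset Printing Implicit Defensive.

Import Order.TTheory GRing.Theory Num.Theory.

Local Open Scope ring_scope.

(* C(i1) is R[i]; [Bicomplex z1 z2] stands for z1 + z2 i2. *)
Record bicomplex (R : Type) := Bicomplex { bc_fst : R[i]; bc_snd : R[i] }.

Section BicomplexRing.
Variable R : realType.
Local Notation T := (bicomplex R).

Definition bc_to_pair (w : T) : R[i] * R[i] := (bc_fst w, bc_snd w).
Definition bc_of_pair (p : R[i] * R[i]) : T := Bicomplex p.1 p.2.

Lemma bc_to_pairK : cancel bc_to_pair bc_of_pair.
Proof. by case. Qed.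

HB.instance Definition _ := Choice.copy T (can_type bc_to_pairK).

Definition bc_zero : T := Bicomplex 0 0.
Definition bc_one : T := Bicomplex 1 0.
Definition bc_opp (w : T) : T := Bicomplex (- bc_fst w) (- bc_snd w).
Definition bc_add (v w : T) : T :=
  Bicomplex (bc_fst v + bc_fst w) (bc_snd v + bc_snd w).
Definition bc_mul (v w : T) : T :=
  Bicomplex (bc_fst v * bc_fst w - bc_snd v * bc_snd w)
            (bc_fst v * bc_snd w + bc_snd v * bc_fst w).

Lemma bc_addA : associative bc_add.
Proof. by move=> u v w; congr Bicomplex; rewrite /= addrA. Qed.

Lemma bc_addC : commutative bc_add.
Proof. by move=> u v; congr Bicomplex; rewrite /= addrC. Qed.

Lemma bc_add0 : left_id bc_zero bc_add.
Proof. by case=> a b; congr Bicomplex; rewrite /= add0r. Qed.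

Lemma bc_addN : left_inverse bc_zero bc_opp bc_add.
Proof. by move=> u; congr Bicomplex; rewrite /= addNr. Qed.

HB.instance Definition _ :=
  GRing.isZmodule.Build T bc_addA bc_addC bc_add0 bc_addN.

Lemma bc_mulA : associative bc_mul.
Proof.
move=> [a b] [c d] [e f]; rewrite /bc_mul /=; congr Bicomplex; ring.
Qed.

Lemma bc_mulC : commutative bc_mul.
Proof.
move=> [a b] [c d]; rewrite /bc_mul /=; congr Bicomplex; ring.
Qed.

Lemma bc_mul1 : left_id bc_one bc_mul.
Proof. by case=> a b; rewrite /bc_mul /= !mul1r !mul0r subr0 addr0. Qed.

Lemma bc_mulDl : left_distributive bc_mul bc_add.
Proof.
move=> [a b] [c d] [e f]; rewrite /bc_mul /bc_add /=; congr Bicomplex; ring.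
Qed.

Lemma bc_oner_neq0 : bc_one != 0 :> T.
Proof. by apply/eqP => -[] /eqP; rewrite oner_eq0. Qed.

HB.instance Definition _ := GRing.Zmodule_isComNzRing.Build T
  bc_mulA bc_mulC bc_mul1 bc_mulDl bc_oner_neq0.

Definition of_C (z : R[i]) : T := Bicomplex z 0.

Lemma of_C_is_zmod_morphism : zmod_morphism of_C.
Proof. by move=> x y; congr Bicomplex; rewrite /= subr0. Qed.

Lemma of_C_is_monoid_morphism : monoid_morphism of_C.
Proof.
split=> // x y; congr Bicomplex; rewrite /=; first by rewrite mul0r subr0.
by rewrite mulr0 mul0r addr0.
Qed.

HB.instance Definition _ :=
  GRing.isZmodMorphism.Build R[i] T of_C of_C_is_zmod_morphism.
HB.instance Definition _ :=
  GRing.isMonoidMorphism.Build R[i] T of_C of_C_is_monoid_morphism.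

Definition bc_i1 : T := of_C 'i%C.
Definition bc_i2 : T := Bicomplex 0 1.
Definition bc_j : T := bc_i1 * bc_i2.

End BicomplexRing.

Arguments bc_i1 {R}.
Arguments bc_i2 {R}.
Arguments bc_j {R}.

Variant bc_index := ix1 | ix2.

Section Idempotents.
Variable R : realType.
Local Notation T := (bicomplex R).

Definition bc_e (k : bc_index) : T :=
  match k with
  | ix1 => of_C (1 / 2%:R) * (1 + bc_j)
  | ix2 => of_C (1 / 2%:R) * (1 - bc_j)
  end.

(* The idempotent components of w = z1 + z2 i2; that these are the unique
   coefficients of w along e1 and e2 is [bc_idem_decomp] and [bc_P_comb]. *)
Definition bc_P (k : bc_index) (w : T) : R[i] :=
  match k with
  | ix1 => bc_fst w - 'i%C * bc_snd w
  | ix2 => bc_fst w + 'i%C * bc_snd w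
  end.

Definition bc_dag3 (w : T) : T :=
  of_C (conjc (bc_P ix1 w)) * bc_e ix1 + of_C (conjc (bc_P ix2 w)) * bc_e ix2.

Definition hyp_nonneg (w : T) : Prop :=
  exists x1 x2 : R, [/\ 0 <= x1, 0 <= x2 &
    w = of_C x1%:C%C * bc_e ix1 + of_C x2%:C%C * bc_e ix2].

Lemma bc_eE k :
  bc_e k = Bicomplex (1 / 2%:R)
             (if k is ix1 then 'i%C / 2%:R else - ('i%C / 2%:R)).
Proof.
by case: k; congr Bicomplex => /=; field.
Qed.

Let ii : 'i%C * 'i%C = -1 :> R[i].
Proof. by rewrite -expr2 sqr_i. Qed.

Lemma bc_combE (a b : R[i]) :
  of_C a * bc_e ix1 + of_C b * bc_e ix2 =
  Bicomplex ((a + b) / 2%:R) ('i%C * (a - b) / 2%:R).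
Proof.
by rewrite !bc_eE; congr Bicomplex => /=; field.
Qed.

Lemma bc_P_comb (z1 z2 : R[i]) k :
  bc_P k (of_C z1 * bc_e ix1 + of_C z2 * bc_e ix2) =
  if k is ix1 then z1 else z2.
Proof.
rewrite bc_combE /bc_P /= !mulrA ii.
by case: k; field.
Qed.

Lemma bc_idem_decomp (w : T) :
  w = of_C (bc_P ix1 w) * bc_e ix1 + of_C (bc_P ix2 w) * bc_e ix2.
Proof.
case: w => a b; rewrite bc_combE /bc_P /=; congr Bicomplex; first by field.
have -> : 'i%C * (a - 'i%C * b - (a + 'i%C * b)) = - ('i%C * 'i%C) * (b * 2%:R).
  by ring.
by rewrite ii; field.
Qed.

End Idempotents.

Arguments bc_e {R} k.

(* M seen as a C(i1)-space, by restriction of scalars along of_C. *)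
Definition restrC (R : realType) (M : lmodType (bicomplex R)) : Type := M.

Section RestrC.
Variables (R : realType) (M : lmodType (bicomplex R)).

HB.instance Definition _ := GRing.Zmodule.on (restrC M).

Definition restrC_scale (z : R[i]) (x : restrC M) : restrC M :=
  of_C z *: (x : M).

Lemma restrC_scaleA a b v :
  restrC_scale a (restrC_scale b v) = restrC_scale (a * b) v.
Proof. by rewrite /restrC_scale rmorphM scalerA. Qed.

Lemma restrC_scale1 : left_id 1 restrC_scale.
Proof. by move=> v; rewrite /restrC_scale rmorph1 scale1r. Qed.

Lemma restrC_scaleDr : right_distributive restrC_scale +%R.
Proof. by move=> a u v; rewrite /restrC_scale scalerDr. Qed.

Lemma restrC_scaleDl v : {morph restrC_scale^~ v : a b / a + b}.
Proof. by move=> a b; rewrite /restrC_scale rmorphD scalerDl. Qed.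

HB.instance Definition _ := GRing.Zmodule_isLmodule.Build R[i] (restrC M)
  restrC_scaleA restrC_scale1 restrC_scaleDr restrC_scaleDl.

Definition in_Vk (k : bc_index) : {pred restrC M} :=
  fun x => `[< exists psi : M, x = bc_e k *: psi >].

Lemma in_Vk_submod k : submod_closed (in_Vk k).
Proof.
split; first by apply/asboolP; exists 0; rewrite scaler0.
move=> a u v /asboolP[x ->] /asboolP[y ->]; apply/asboolP.
exists (of_C a *: x + y).
by rewrite scalerDr scalerA mulrC -scalerA.
Qed.

HB.instance Definition _ k :=
  GRing.isSubmodClosed.Build R[i] (restrC M) (in_Vk k) (in_Vk_submod k).

(* V_k = e_k M, as a C(i1)-vector space. *)
Record Vk (k : bc_index) :=
  MkVk { Vk_val : restrC M; Vk_valP : Vk_val \in in_Vk k }.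

HB.instance Definition _ k := [isSub for @Vk_val k].
HB.instance Definition _ k := [Choice of Vk k by <:].
HB.instance Definition _ k := [SubChoice_isSubLmodule of Vk k by <:].

End RestrC.

Section Completeness.
Variables (R : realType) (V : zmodType) (nrm : V -> R).

Definition is_cauchy_seq (u : nat -> V) : Prop :=
  forall eps : R, 0 < eps -> exists N : nat,
    forall m n : nat, (N <= m)%N -> (N <= n)%N -> nrm (u m - u n) < eps.

Definition converges_to (u : nat -> V) (l : V) : Prop :=
  forall eps : R, 0 < eps -> exists N : nat,
    forall n : nat, (N <= n)%N -> nrm (u n - l) < eps.

Definition complete_for : Prop :=
  forall u : nat -> V, is_cauchy_seq u -> exists l : V, converges_to u l.

End Completeness.

Section BicomplexHilbert.
Variables (R : realType) (M : lmodType (bicomplex R)).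
Variable sp : M -> M -> bicomplex R.

Record bicomplex_inner_product : Prop := {
  bip_addr : forall psi phi chi, sp psi (phi + chi) = sp psi phi + sp psi chi;
  bip_scaler : forall alpha psi phi, sp psi (alpha *: phi) = alpha * sp psi phi;
  bip_dag : forall psi phi, sp psi phi = bc_dag3 (sp phi psi);
  bip_def : forall psi, sp psi psi = 0 <-> psi = 0;
  bip_hyp_pos : forall psi, hyp_nonneg (sp psi psi)
}.

(* Under [bip_hyp_pos] the two components are nonnegative reals; [complex.Re]
   only turns them into elements of R. *)
Definition bicomplex_norm (phi : M) : R :=
  1 / Num.sqrt 2%:R *
  Num.sqrt
    (complex.Re (bc_P ix1 (sp (bc_e ix1 *: phi) (bc_e ix1 *: phi))) +
     complex.Re (bc_P ix2 (sp (bc_e ix2 *: phi) (bc_e ix2 *: phi)))).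

Definition bicomplex_hilbert : Prop :=
  bicomplex_inner_product /\ complete_for bicomplex_norm.

End BicomplexHilbert.

Section ComplexHilbert.
Variables (R : realType) (V : lmodType R[i]).
Variable sp : V -> V -> R[i].

(* In R[i], [0 <= z] means that z is real and nonnegative. *)
Record complex_inner_product : Prop := {
  cip_addr : forall x y z, sp x (y + z) = sp x y + sp x z;
  cip_scaler : forall a x y, sp x (a *: y) = a * sp x y;
  cip_conj : forall x y, sp x y = conjc (sp y x);
  cip_pos : forall x, 0 <= sp x x;
  cip_def : forall x, sp x x = 0 <-> x = 0
}.

Definition complex_norm (x : V) : R := Num.sqrt (complex.Re (sp x x)).

Definition complex_hilbert : Prop :=
  complex_inner_product /\ complete_for complex_norm.

End ComplexHilbert.

Definition sp_comp (R : realType) (M : lmodType (bicomplex R))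
    (sp : M -> M -> bicomplex R) (k : bc_index) (x y : Vk M k) : R[i] :=
  bc_P k (sp (Vk_val x) (Vk_val y)).

(* Main.v *)
Require Import Defs.
From mathcomp Require Import all_boot all_order all_algebra.
From mathcomp Require Import boolp reals complex ring.

(** For x in V_k one has e_k x = x while the other idempotent kills x, so only
    the k-th component of (x, x) survives: (x, x) = (x, x)_k e_k.  Hence
    definiteness and positivity pass to (., .)_k, and the norm of V_k is sqrt 2
    times the restriction of the T-norm.  Since phi |-> e_k phi does not increase
    the T-norm, projecting the limit in M of a Cauchy sequence of V_k gives its
    limit in V_k. *)

Import Order.TTheory GRing.Theory Num.Theory.
Local Open Scope ring_scope.

(** Naming the complementary index lets the arguments below treat both values of k at once. *)
Definition bc_other (k : bc_index) : bc_index := if k is ix1 then ix2 else ix1.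

Section Components.
Variable R : realType.
Implicit Types (v w : bicomplex R) (k : bc_index).

Lemma bc_PD k v w : bc_P k (v + w) = bc_P k v + bc_P k w.
Proof. by case: k v w => -[a b] [c d] /=; ring. Qed.

Lemma bc_PM k v w : bc_P k (v * w) = bc_P k v * bc_P k w.
Proof.
have ii : 'i%C * 'i%C = -1 :> R[i] by rewrite -expr2 sqr_i.
(* [ring] treats 'i as an indeterminate, so the sign is first written as 'i * 'i; what remains is a
   polynomial identity. *)
have E (a b c d : R[i]) : a * c - b * d = a * c + ('i%C * 'i%C) * (b * d).
  by rewrite ii mulN1r.
by case: k v w => -[a b] [c d] /=; rewrite E; ring.
Qed.

Lemma bc_P_of_C k z : bc_P k (of_C z : bicomplex R) = z.
Proof. by case: k; rewrite /= mulr0 ?subr0 ?addr0. Qed.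

Lemma bc_P0 k : bc_P k (0 : bicomplex R) = 0.
Proof. exact: (bc_P_of_C k 0). Qed.

(** Used to check identities in T one idempotent component at a time, where products are those of
    C(i1). *)
Lemma bc_P_inj k v w :
  bc_P k v = bc_P k w -> bc_P (bc_other k) v = bc_P (bc_other k) w -> v = w.
Proof.
by case: k => E1 E2; rewrite [v]bc_idem_decomp [w]bc_idem_decomp E1 E2.
Qed.

Lemma bc_P_e k : bc_P k (bc_e k : bicomplex R) = 1.
Proof.
(* e_k is the idempotent combination with coefficients 1, 0 or 0, 1. *)
by case: k; [have := bc_P_comb (1 : R[i]) 0 ix1 | have := bc_P_comb (0 : R[i]) 1 ix2];
  rewrite !rmorph0 !rmorph1 !mul0r !mul1r ?addr0 ?add0r.
Qed.

Lemma bc_P_other_e k : bc_P (bc_other k) (bc_e k : bicomplex R) = 0.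
Proof.
by case: k; [have := bc_P_comb (1 : R[i]) 0 ix2 | have := bc_P_comb (0 : R[i]) 1 ix1];
  rewrite !rmorph0 !rmorph1 !mul0r !mul1r ?addr0 ?add0r.
Qed.

Lemma bc_other_otherK k : bc_other (bc_other k) = k.
Proof. by case: k. Qed.

Lemma bc_e_idem k : bc_e k * bc_e k = bc_e k :> bicomplex R.
Proof.
by apply: (@bc_P_inj k); rewrite bc_PM ?bc_P_e ?bc_P_other_e ?mulr1 ?mulr0.
Qed.

Lemma bc_e_other k : bc_e (bc_other k) * bc_e k = 0 :> bicomplex R.
Proof.
apply: (@bc_P_inj k); rewrite bc_PM bc_P0 ?bc_P_other_e ?mulr0 //.
(* Reading k as the other of its other puts the first factor in the form of [bc_P_other_e]. *)
by rewrite -{1}(bc_other_otherK k) bc_P_other_e mul0r.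
Qed.

Lemma bc_P_dag3 k w : bc_P k (bc_dag3 w) = conjc (bc_P k w).
Proof. by rewrite /bc_dag3 bc_P_comb; case: k. Qed.

Lemma bc_P_ge0 k w : hyp_nonneg w -> 0 <= bc_P k w.
Proof.
by case=> x1 [x2 [x1_ge0 x2_ge0 ->]]; rewrite bc_P_comb; case: k; rewrite lecR.
Qed.

Lemma Re_bc_P_ge0 k w : hyp_nonneg w -> 0 <= complex.Re (bc_P k w).
Proof. by move=> /(bc_P_ge0 k); case: (bc_P k w) => a b; rewrite lecE => /andP[]. Qed.

End Components.

Lemma Vk_e (R : realType) (M : lmodType (bicomplex R)) k (x : Vk M k) :
  bc_e k *: (Vk_val x : M) = Vk_val x.
Proof. by case: x => x /= /asboolP[psi ->]; rewrite scalerA bc_e_idem. Qed.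

Section Norm.
Variables (R : realType) (M : lmodType (bicomplex R)).
Variable sp : M -> M -> bicomplex R.
Hypothesis sp_ip : bicomplex_inner_product sp.
Implicit Types (phi psi : M) (k : bc_index).

Lemma bc_P_other_sp_e k phi psi : bc_P (bc_other k) (sp phi (bc_e k *: psi)) = 0.
Proof. by rewrite (bip_scaler sp_ip) bc_PM bc_P_other_e mul0r. Qed.

Lemma bicomplex_normE k phi : bicomplex_norm sp phi =
  1 / Num.sqrt 2%:R * Num.sqrt
    (complex.Re (bc_P k (sp (bc_e k *: phi) (bc_e k *: phi))) +
     complex.Re (bc_P (bc_other k)
       (sp (bc_e (bc_other k) *: phi) (bc_e (bc_other k) *: phi)))).
Proof. by case: k => //; rewrite addrC. Qed.

Lemma bicomplex_norm_e k phi : bicomplex_norm sp (bc_e k *: phi) =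
  1 / Num.sqrt 2%:R *
  Num.sqrt (complex.Re (bc_P k (sp (bc_e k *: phi) (bc_e k *: phi)))).
Proof.
rewrite (bicomplex_normE k) !scalerA bc_e_idem bc_e_other scale0r.
by rewrite (proj2 (bip_def sp_ip 0) erefl) bc_P0 addr0.
Qed.

(** The right side has one more term under the root, nonnegative by hyperbolic positivity. *)
Lemma bicomplex_norm_e_le k phi :
  bicomplex_norm sp (bc_e k *: phi) <= bicomplex_norm sp phi.
Proof.
rewrite bicomplex_norm_e (bicomplex_normE k) ler_wpM2l ?divr_ge0 ?sqrtr_ge0 //.
by rewrite ler_wsqrtr // lerDl Re_bc_P_ge0 //; apply: (bip_hyp_pos sp_ip).
Qed.

Lemma complex_norm_sp_comp k (x : Vk M k) :
  complex_norm (sp_comp sp (k := k)) x =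
  Num.sqrt 2%:R * bicomplex_norm sp (Vk_val x).
Proof.
(* [Vk_e] inserts e_k to reach the one-term formula and then removes it. *)
rewrite -Vk_e bicomplex_norm_e Vk_e mulrA mul1r divff ?mul1r //.
by rewrite sqrtr_eq0 -ltNge ltr0n.
Qed.

Lemma sp_comp_inner_product k : complex_inner_product (sp_comp sp (k := k)).
Proof.
split=> [x y z|a x y|x y|x|x]; rewrite /sp_comp.
- have -> : Vk_val (y + z) = (Vk_val y : M) + Vk_val z by [].
  by rewrite (bip_addr sp_ip) bc_PD.
- have -> : Vk_val (a *: y) = of_C a *: (Vk_val y : M) by [].
  by rewrite (bip_scaler sp_ip) bc_PM bc_P_of_C.
- by rewrite (bip_dag sp_ip) bc_P_dag3.
- exact/bc_P_ge0/(bip_hyp_pos sp_ip).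
- split=> [Pk0|->]; last first.
    by rewrite (proj2 (bip_def sp_ip _)) ?bc_P0.
  apply: val_inj; apply: (proj1 (bip_def sp_ip _)).
  apply: (@bc_P_inj _ k); first by rewrite bc_P0.
  (* The other component vanishes because x = e_k x in the second argument. *)
  by rewrite bc_P0 -(bc_P_other_sp_e k (Vk_val x) (Vk_val x)) Vk_e.
Qed.

Lemma sp_comp_complete k : complete_for (bicomplex_norm sp) ->
  complete_for (complex_norm (sp_comp sp (k := k))).
Proof.
move=> M_complete u u_cauchy.
have s2_gt0 : 0 < Num.sqrt 2%:R :> R by rewrite sqrtr_gt0 ltr0n.
have [|l u_l] := M_complete (fun n => Vk_val (u n) : M).
  move=> eps eps_gt0.
  (* The factor sqrt 2 between the two norms rescales the tolerance. *)
  have [N HN] := u_cauchy _ (mulr_gt0 s2_gt0 eps_gt0).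
  exists N => m n Nm Nn; have := HN m n Nm Nn.
  by rewrite complex_norm_sp_comp ltr_pM2l.
(* l is only known to lie in M; e_k l is the candidate limit in V_k. *)
have el_in : (bc_e k *: l : restrC M) \in in_Vk k by apply/asboolP; exists l.
exists (MkVk el_in) => eps eps_gt0.
have [N HN] := u_l _ (divr_gt0 eps_gt0 s2_gt0).
exists N => n Nn; rewrite complex_norm_sp_comp mulrC -ltr_pdivlMr //.
apply: le_lt_trans (HN n Nn).
(* As e_k fixes u n, the difference is the e_k-projection of u n - l. *)
have -> : Vk_val (u n - MkVk el_in) = bc_e k *: ((Vk_val (u n) : M) - l).
  by rewrite scalerBr Vk_e.
exact: bicomplex_norm_e_le.
Qed.

End Norm.

Theorem corollary3p6 (R : realType) (M : lmodType (bicomplex R))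
  (sp : M -> M -> bicomplex R) (HM : bicomplex_hilbert sp) (k : bc_index) :
  complex_hilbert (sp_comp sp (k := k)).
Proof.
case: HM => sp_ip M_complete.
by split; [apply: sp_comp_inner_product | apply: sp_comp_complete].
Qed.
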